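(* Let $m,n\ge1$ be integers. Suppose $d\ge 0$, and $a_0,\dots,a_d,b_0,\dots,b_d\in[0,n]$ satisfy $$\sum_{k=0}^d a_k=\sum_{k=0}^d b_k\qquad\text{and}\qquad a_k,b_k\ge n-m\quad\text{for } k=0,\dots,d.$$ Set $$I=\bigcup_{k=0}^d[(k+1)n+1-a_k,(k+1)n],\qquad J=\bigcup_{k=0}^d[kn+1,kn+b_k].$$ Then $$\Delta_{I,J}(\widetilde{M})=\sum_{(X_1,\dots,X_d)}\ \prod_{k=0}^d\Delta_{X_k\cup[m-(n-b_{k-1})+1,\,m],\ [1,n-a_{k+1}]\cup X_{k+1}}(\overline{M}),$$ where $a_{d+1}=b_{-1}=n$, $X_0=[n-a_0+1,m]$, $X_{d+1}=[1,m-(n-b_d)]$, and the sum is over all tuples of subsets $X_k\subseteq[n-a_k+1,\,m-(n-b_{k-1})]$ ($k=1,\dots,d$); here the $X_k$ must satisfy $|X_k|+(n-b_{k-1})=(n-a_{k+1})+|X_{k+1}|$ for all $0\le k\le d$, so that all the minors are square.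
   Context: $[a,b]=\{k\in\mathbb{Z}:a\le k\le b\}$ (empty if $a>b$). The $x_i^j$ ($i\in[1,m]$, $j\in[1,n]$) are independent indeterminates over $\mathbb{C}$. For $i\in[1,m]$ and $r\in\mathbb{Z}$, put $x_i^{(r)}=x_i^j$ where $j\in[1,n]$, $j\equiv r-i+1\pmod n$. The loop elementary symmetric functions are $$E_k^{(r)}=\sum_{1\le i_1<\dots<i_k\le m}x_{i_1}^{(r)}x_{i_2}^{(r+1)}\cdots x_{i_k}^{(r+k-1)}\quad(1\le k\le m,\ r\in\mathbb{Z}),$$ with $E_0^{(r)}=1$ and $E_k^{(r)}=0$ for $k<0$ or $k>m$. $\widetilde{M}$ is the $\mathbb{Z}\times\mathbb{Z}$ matrix with entries $\widetilde{M}_{ij}=E^{(i)}_{m+j-i}$. For $y=(y_1,\dots,y_m)$ let $W(y)$ be the $m\times m$ matrix with $y_1,\dots,y_m$ on the diagonal, $1$'s in positions $(i+1,i)$, and zeros elsewhere. $\overline{M}=W(\mathbf{x}^1)W(\mathbf{x}^2)\cdots W(\mathbf{x}^n)$ (an $m\times m$ matrix), where $\mathbf{x}^j=(x_1^j,\dots,x_m^j)$. $\Delta_{A,B}(N)$ is the determinant of the submatrix of $N$ with rows $A$ and columns $B$ in increasing order; an empty minor is $1$.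
   Formalization: The formal theorem adds the hypothesis n-a_k ≤ m-(n-b_{k-1}) for k=1,…,d; without it the claim fails, e.g. m=n=d=1 and all a_k=b_k=0, where the left side is 1 and the sum is empty. *)

(* Defs.v *)
From HB Require Import structures.
From mathcomp Require Import all_boot all_order all_algebra.
From mathcomp Require Import finmap reals complex mpoly.

Set Implicit Arguments.
Unset Strict Implicit.
Unset Printing Implicit Defensive.

Import Order.TTheory GRing.Theory Num.Theory.
Local Open Scope ring_scope.

(* Elements of [1, m] and [1, n] are encoded by 'I_m and 'I_n: the ordinal i
   stands for the index i.+1. *)

Section LoopSymmetricFunctions.

Variables (R : comNzRingType) (m n : nat) (x : 'I_m -> 'I_n -> R).

(* x_i^(r) = x_i^j for the j in [1, n] with j = r - i + 1 mod n; such a j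
   exists and is unique as soon as 0 < n. *)
Definition loop_var (r : int) (i : 'I_m) : R :=
  if [pick j : 'I_n | (j.+1%:Z == r - i.+1%:Z + 1 %[mod n])%Z] is Some j
  then x i j else 0.

(* The sum gives E_0 = 1 (one empty tuple) and E_k = 0 for k > m (no strictly
   increasing tuple). *)
Definition loopE (k : int) (r : int) : R :=
  if k is Posz k' then
    \sum_(t : k'.-tuple 'I_m | sorted ltn (map val t))
      \prod_(s < k') loop_var (r + s%:Z) (tnth t s)
  else 0.

Definition Mtilde (i j : int) : R := loopE (m%:Z + j - i) i.

Definition whirl (y : 'I_m -> R) : 'M[R]_m :=
  \matrix_(i, j) if i == j then y i else if i == j.+1 :> nat then 1 else 0.

Definition Mbar : 'M[R]_m :=
  \big[mulmx/1%:M]_(j < n) whirl (fun i => x i j).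

End LoopSymmetricFunctions.

(* Determinant of the matrix (N a b) whose rows are listed by s and columns by
   t; meaningful when size s = size t. *)
Definition minor_seq (R : comNzRingType) (T : Type) (N : T -> T -> R)
    (s t : seq T) : R :=
  \det (\matrix_(i < size s, j < size s)
          (nth [::] [seq [seq N a b | b <- t] | a <- s] i)`_j).

Definition minorZ (R : comNzRingType) (N : int -> int -> R)
    (A B : {fset int}) : R :=
  minor_seq N (sort <=%R (enum_fset A)) (sort <=%R (enum_fset B)).

(* enum lists a set of ordinals in increasing order. *)
Definition minorM (R : comNzRingType) (m : nat) (N : 'M[R]_m)
    (A B : {set 'I_m}) : R :=
  minor_seq (fun i j => N i j) (enum A) (enum B).

Definition itvZ (lo hi : int) : {fset int} :=
  [fset (lo + i%:Z)%R | i in iota 0 (absz (Num.max 0 (hi - lo + 1))%R)]%fset.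

Definition itvM (m lo hi : nat) : {set 'I_m} :=
  [set i : 'I_m | (lo <= i.+1 <= hi)%N].
Arguments itvM : clear implicits.

Definition setI_ (n d : nat) (a : nat -> nat) : {fset int} :=
  \big[fsetU/fset0]_(k < d.+1)
    itvZ ((k.+1 * n)%:Z + 1 - (a k)%:Z) (k.+1 * n)%:Z.

Definition setJ_ (n d : nat) (b : nat -> nat) : {fset int} :=
  \big[fsetU/fset0]_(k < d.+1)
    itvZ ((k * n)%:Z + 1) ((k * n)%:Z + (b k)%:Z).

Section Tuples.

(* Only a_0, ..., a_d and b_0, ..., b_d are used. *)
Variables (m n d : nat) (a b : nat -> nat).

(* a_k for k <= d, and a_(d+1) = n *)
Definition a_ext (k : nat) : nat := if (k <= d)%N then a k else n.

(* b_(k-1), with b_(-1) = n *)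
Definition b_prev (k : nat) : nat := if k is k'.+1 then b k' else n.

(* X_k for k = 0, ..., d+1; the tuple X is (X_1, ..., X_d). *)
Definition X_ext (X : d.-tuple {set 'I_m}) (k : nat) : {set 'I_m} :=
  nth (itvM m 1 (m - (n - b d))) (itvM m (n - a 0 + 1) m :: X) k.

Definition rowset (X : d.-tuple {set 'I_m}) (k : nat) : {set 'I_m} :=
  X_ext X k :|: itvM m (m - (n - b_prev k) + 1) m.

Definition colset (X : d.-tuple {set 'I_m}) (k : nat) : {set 'I_m} :=
  itvM m 1 (n - a_ext k.+1) :|: X_ext X k.+1.

(* The range [n-a_k+1, m-(n-b_(k-1))] of X_k separates [1, n-a_k] from
   [m-(n-b_(k-1))+1, m]. When these two overlap, that is when
   n - a_k > m - (n - b_(k-1)), the range is empty and summing over X_k = set0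
   does not compute the minor of Mtilde: for m = n = d = 1 and a = b = 0 that
   minor is the empty one while no X is admissible. *)
Definition admissible (X : d.-tuple {set 'I_m}) : bool :=
  [forall k : 'I_d,
     X_ext X k.+1 \subset itvM m (n - a k.+1 + 1) (m - (n - b k))] &&
  [forall k : 'I_d.+1,
     #|X_ext X k| + (n - b_prev k) == (n - a_ext k.+1) + #|X_ext X k.+1|]%N.

End Tuples.

Definition indet (C : comNzRingType) (m n : nat) (i : 'I_m) (j : 'I_n) :
    {mpoly C[m * n]} :=
  'X_(mxvec_index i j).

(* Main.v *)
(* Mtilde is, on each finite window, a product of m whirls, the i-th one having
   x_i^(p mod n) at its p-th diagonal place, while Mbar is the product of the n whirls
   with the x_1^j, ..., x_m^j on their diagonals: both are transfer matrices of
   the same grid, read in perpendicular directions.  By Cauchy-Binet, a minor of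
   either is a partition function of nonintersecting paths, that is, of a
   five-vertex model, and exchanging particles and holes turns the model read by
   rows into the model read by columns.  Under this exchange the gaps of I become
   steps at which a path of Mbar leaves at position 1, and the gaps of J steps at
   which one enters at position m.  Inside each block of n steps the exits come
   first and the entries last, so these paths are frozen; removing them leaves one
   minor of Mbar per block, and X_k records the remaining paths between the blocks
   k - 1 and k. *)
Require Import Defs.
From HB Require Import structures.
From mathcomp Require Import all_boot all_order all_algebra.
From mathcomp Require Import finmap reals complex mpoly.
From mathcomp Require Import perm zify.

Set Implicit Arguments.
Unset Strict Implicit.
Unset Printing Implicit Defensive.

Import Order.TTheory GRing.Theory Num.Theory.
Local Open Scope ring_scope.

(** * Minors and the Cauchy-Binet formula *)

Section CauchyBinet.
Variable R : comNzRingType.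

Lemma det_rows_perm k n (G : 'M[R]_(n, k)) (c : 'I_k -> 'I_n) (s : 'S_k) :
  \det (\matrix_(i, j) G (c (s i)) j) =
  (-1) ^+ s * \det (\matrix_(i, j) G (c i) j).
Proof.
rewrite -det_perm -det_mulmx -row_permE; congr (\det _).
by apply/matrixP => i j; rewrite !mxE.
Qed.

(** When the product over the rows is distributed, [f i] is the summation index chosen in row [i] of
    the matrix product. *)
Lemma det_mulmx_ffun k n (F : 'M[R]_(k, n)) (G : 'M[R]_(n, k)) :
  \det (F *m G) = \sum_(f : {ffun 'I_k -> 'I_n})
     (\prod_i F i (f i)) * \det (\matrix_(i, j) G (f i) j).
Proof.
rewrite {1}/determinant.
under eq_bigr => s _.
  under eq_bigr => i _ do rewrite mxE.
  rewrite bigA_distr_bigA /= big_distrr /=.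
  over.
rewrite exchange_big /=; apply: eq_bigr => f _.
rewrite big_distrr /=; apply: eq_bigr => s _.
rewrite big_split /= mulrCA; congr (_ * (_ * _)).
by apply: eq_bigr => i _; rewrite mxE.
Qed.

(** Maps [f] with a repeated value give two equal rows. The others are grouped by their image [C],
    and each group is the orbit of [c C] under permutations. *)
Lemma Cauchy_Binet k n (F : 'M[R]_(k, n)) (G : 'M[R]_(n, k))
    (c : {set 'I_n} -> 'I_k -> 'I_n)
    (c_inj : forall C : {set 'I_n}, #|C| = k -> injective (c C))
    (c_mem : forall (C : {set 'I_n}) i, #|C| = k -> c C i \in C) :
  \det (F *m G) = \sum_(C : {set 'I_n} | #|C| == k)
     \det (\matrix_(i, j) F i (c C j)) * \det (\matrix_(i, j) G (c C i) j).
Proof.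
rewrite det_mulmx_ffun (bigID (fun f : {ffun _} => injectiveb f)) /=.
rewrite [X in _ + X]big1 ?addr0; last first.
  move=> f /injectivePn[i1 [i2 neq_i eq_f]].
  by rewrite (determinant_alternate neq_i) ?mulr0 // => j; rewrite !mxE eq_f.
rewrite (partition_big (fun f : {ffun 'I_k -> 'I_n} => f @: [set: 'I_k])
  (fun C => #|C| == k)) /=; last first.
  by move=> f /injectiveP f_inj; rewrite card_imset // cardsT card_ord.
apply: eq_bigr => C /eqP C_k.
have cE : c C @: [set: 'I_k] = C.
  apply/eqP; rewrite eqEcard card_imset ?cardsT ?card_ord ?C_k ?leqnn ?andbT.
    by apply/subsetP=> _ /imsetP[i _ ->]; exact: c_mem.
  exact: c_inj.
pose h (s : 'S_k) := [ffun i => c C (s i)].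
have h_inj : injective h.
  move=> s1 s2 /ffunP eq_h; apply/permP => i.
  by apply: (c_inj C C_k); have := eq_h i; rewrite !ffunE.
rewrite (eq_bigl (mem (h @: [set: 'S_k]))); last first.
  move=> f; apply/idP/imsetP => [/andP[/injectiveP f_inj /eqP fC]|[s _ ->]].
    have /fin_all_exists[s sE] i : exists j, c C j = f i.
      have: f i \in C by rewrite -fC imset_f.
      by rewrite -{1}cE => /imsetP[j _ ->]; exists j.
    have s_inj : injective s.
      by move=> i j eq_s; apply: f_inj; rewrite -!sE eq_s.
    by exists (perm s_inj); rewrite // /h; apply/ffunP => i; rewrite ffunE permE sE.
  have hs_inj : injective (h s).
    by move=> i j; rewrite !ffunE => /(c_inj C C_k); exact: perm_inj.
  apply/andP; split; first exact/injectiveP.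
  rewrite eqEcard card_imset // cardsT card_ord C_k leqnn andbT.
  by apply/subsetP=> _ /imsetP[i _ ->]; rewrite ffunE c_mem.
rewrite big_imset /=; last by move=> s1 s2 _ _; exact: h_inj.
(* The sign from reordering the rows of [G] by [s] is the one that the determinant of the [F] part
   requires. *)
rewrite [in RHS]/(\det _) big_distrl big_mkcond /=; apply: eq_bigr => s _.
rewrite inE mulrAC -(det_rows_perm G (c C) s) [RHS]mulrC; congr (_ * _).
  by apply: eq_bigr => i _; rewrite !mxE ffunE.
by congr (\det _); apply/matrixP=> i j; rewrite !mxE ffunE.
Qed.

End CauchyBinet.

(** * Compound matrices *)

Section Compound.
Variable R : comNzRingType.

Lemma minor_seqE (T : Type) (x0 : T) (N : T -> T -> R) (s t : seq T) k :
  size s = k -> size t = k ->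
  minor_seq N s t = \det (\matrix_(i < k, j < k) N (nth x0 s i) (nth x0 t j)).
Proof.
move=> <- st; rewrite /minor_seq; congr (\det _); apply/matrixP => i j.
by rewrite !mxE (nth_map x0) // (nth_map x0) ?st.
Qed.

Lemma minor_seq_map (T U : Type) (f : T -> U) (N : U -> U -> R) (s t : seq T) :
  size s = size t ->
  minor_seq N (map f s) (map f t) = minor_seq (fun a b => N (f a) (f b)) s t.
Proof.
case: s t => [|x0 s] t st; first by case: t st.
rewrite (minor_seqE (f x0) _ (k := size (x0 :: s))) ?size_map //.
rewrite (minor_seqE x0 _ (k := size (x0 :: s))) //; congr (\det _).
by apply/matrixP => i j; rewrite !mxE !(nth_map x0) // -st.
Qed.

Lemma eq_minor_seq (T : eqType) (N N' : T -> T -> R) (s t : seq T) :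
  size s = size t -> {in s & t, N =2 N'} -> minor_seq N s t = minor_seq N' s t.
Proof.
case: s t => [|x0 s] t st eqN; first by case: t st eqN.
rewrite !(minor_seqE x0 _ (k := size (x0 :: s))) //; congr (\det _).
by apply/matrixP => i j; rewrite !mxE eqN // mem_nth // -st.
Qed.

(* Forcing the value 0 on non-square minors makes the compound matrix
   multiplicative over all pairs of sets. *)
Definition minor0 m (N : 'M[R]_m) (A B : {set 'I_m}) : R :=
  if #|A| == #|B| then minorM N A B else 0.

Lemma minor0_mul m (N P : 'M[R]_m) A B :
  minor0 (N *m P) A B = \sum_C minor0 N A C * minor0 P C B.
Proof.
rewrite /minor0; case: eqP => [AB|neqAB]; last first.
  rewrite big1 // => C _; case: eqP => AC; last by rewrite mul0r.
  by case: eqP => CB; rewrite ?mulr0 //; case: neqAB; rewrite AC.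
(* For [m = 0] no element can serve as default for [nth]; the only set is empty and every minor is
   1. *)
case: m => [|m] in N P A B AB *.
  have A0 (C : {set 'I_0}) : C = set0 by apply/setP=> -[].
  rewrite (A0 A) (A0 B) (bigD1 set0) //= big1 => [|C]; last by rewrite (A0 C) eqxx.
  by rewrite !eqxx addr0 /minorM /minor_seq; move: (enum _) (@enum0 'I_0);
     rewrite enum_set0 => _ _ /=; rewrite !det_mx00 mulr1.
rewrite /minorM (minor_seqE ord0 _ (k := #|A|)) -?cardE //.
transitivity (\det ((\matrix_(i < #|A|, j < m.+1) N (nth ord0 (enum A) i) j) *m
                    (\matrix_(i < m.+1, j < #|A|) P i (nth ord0 (enum B) j)))).
  congr (\det _); apply/matrixP=> i j; rewrite !mxE.
  by apply: eq_bigr => l _; rewrite !mxE.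
rewrite (@Cauchy_Binet R #|A| m.+1 _ _ (fun C i => nth ord0 (enum C) i)); first last.
- by move=> C i C_k; rewrite -mem_enum mem_nth // -cardE C_k.
- move=> C C_k i j /eqP; rewrite nth_uniq ?enum_uniq -?cardE ?C_k //.
  by move/eqP/val_inj.
rewrite big_mkcond; apply: eq_bigr => C _; rewrite eq_sym.
case: eqP => AC; last by rewrite mul0r.
rewrite -{1}AC (introT eqP AB); congr (_ * _).
  rewrite (minor_seqE ord0 _ (k := #|A|)) -?cardE //.
  by congr (\det _); apply/matrixP=> i j; rewrite !mxE.
rewrite (minor_seqE ord0 _ (k := #|A|)) -?cardE //.
by congr (\det _); apply/matrixP=> i j; rewrite !mxE.
Qed.

End Compound.

(** * Sums over chains and matrix products *)

Section Chains.
Variables (R : comNzRingType) (T : finType).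

(** An entry of a product of [n] matrices indexed by [T], equally the partition function of [n]
    consecutive steps from state [s] to state [t]. *)
Fixpoint chain_sum n : ('I_n -> T -> T -> R) -> T -> T -> R :=
  match n with
  | 0 => fun _ s t => (s == t)%:R
  | n'.+1 => fun F s t =>
      \sum_u F ord0 s u * chain_sum (fun i => F (lift ord0 i)) u t
  end.

Lemma eq_chain_sum n (F G : 'I_n -> T -> T -> R) s t :
  (forall i u v, F i u v = G i u v) -> chain_sum F s t = chain_sum G s t.
Proof.
elim: n => //= n IHn in F G s *; move=> eqFG.
by apply: eq_bigr => u _; rewrite eqFG; congr (_ * _); apply: IHn.
Qed.

Definition fcons n (s : T) (c : {ffun 'I_n -> T}) : {ffun 'I_n.+1 -> T} :=
  [ffun i => oapp c s (unlift ord0 i)].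

Lemma fcons0 n s (c : {ffun 'I_n -> T}) : fcons s c ord0 = s.
Proof. by rewrite ffunE unlift_none. Qed.

Lemma fconsS n s (c : {ffun 'I_n -> T}) i : fcons s c (lift ord0 i) = c i.
Proof. by rewrite ffunE liftK. Qed.

Lemma sum_fcons n (F : {ffun 'I_n.+1 -> T} -> R) :
  \sum_c F c = \sum_s \sum_c F (fcons s c).
Proof.
rewrite pair_big /= (reindex (fun p => fcons p.1 p.2)) //.
exists (fun c : {ffun 'I_n.+1 -> T} => (c ord0, [ffun i => c (lift ord0 i)])) => [[s c]|c] _ /=.
  by rewrite fcons0; congr pair; apply/ffunP=> i; rewrite ffunE fconsS.
apply/ffunP=> i; case: (unliftP ord0 i) => [j|] ->; last exact: fcons0.
by rewrite fconsS ffunE.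
Qed.

(** Summing over whole sequences of states makes it possible to exchange the two directions of the
    grid. *)
Lemma chain_sumE n (F : 'I_n -> T -> T -> R) s t :
  chain_sum F s t =
  \sum_(c : {ffun 'I_n.+1 -> T} | (c ord0 == s) && (c ord_max == t))
    \prod_(i < n) F i (c (widen_ord (leqnSn n) i)) (c (lift ord0 i)).
Proof.
elim: n => [|n IHn] /= in F s *.
  under eq_bigr => c _ do rewrite big_ord0.
  rewrite big_mkcond sum_fcons /= (bigD1 s) //= [X in _ + X]big1 => [|u us].
    rewrite addr0 (eq_bigr (fun=> (s == t)%:R)) => [|c _].
      by rewrite big_const card_ffun !card_ord expn0 /= addr0.
    have -> : ord_max = ord0 :> 'I_1 by exact: val_inj.
    by rewrite !fcons0 eqxx /=; case: eqP.
  by rewrite big1 // => c _; rewrite fcons0 (negPf us).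
rewrite [RHS]big_mkcond sum_fcons [RHS](bigD1 s) //= [X in _ + X]big1 ?addr0; last first.
  by move=> u us; rewrite big1 // => c _; rewrite fcons0 (negPf us).
under eq_bigr => u _ do rewrite IHn big_distrr /=.
rewrite (exchange_big_dep (fun c : {ffun 'I_n.+1 -> T} => c ord_max == t)) /=;
  last by move=> u c _ /andP[].
rewrite [LHS]big_mkcond; apply: eq_bigr => c _.
have -> : ord_max = lift ord0 ord_max :> 'I_n.+2 by apply: val_inj.
rewrite fcons0 fconsS eqxx /=; case: eqP => //= _.
rewrite (big_pred1 (c ord0)) => [|u]; last by rewrite andbT eq_sym.
rewrite big_ord_recl; congr (F _ _ _ * _).
- have -> : widen_ord (leqnSn n.+1) ord0 = ord0 by apply: val_inj.
  by rewrite fcons0.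
- by rewrite fconsS.
apply: eq_bigr => i _; rewrite -!(fconsS s c); congr (F _ (fcons s c _) _).
exact: val_inj.
Qed.

(** Only the [n] intermediate states are free; the default value of [nth] supplies the final state,
    as it does in [X_ext]. *)
Lemma chain_sum_tuple n (F : nat -> T -> T -> R) s t :
  chain_sum (fun i : 'I_n.+1 => F i) s t =
  \sum_(X : n.-tuple T)
    \prod_(k < n.+1) F k (nth t (s :: X) k) (nth t (s :: X) k.+1).
Proof.
elim: n => [|n IHn] in F s *.
  rewrite [RHS](bigD1 [tuple]) //= [X in _ + X]big1 => [|X]; last by rewrite (tuple0 X).
  rewrite addr0 big_ord1 /= (bigD1 t) //= eqxx mulr1 big1 ?addr0 // => u.
  by rewrite eq_sym => /negPf ->; rewrite mulr0.
transitivity (\sum_u F 0%N s u * chain_sum (fun i : 'I_n.+1 => F i.+1) u t) => //.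
rewrite [RHS](reindex (fun p : T * n.-tuple T => [tuple of p.1 :: p.2])).
  rewrite -(pair_big xpredT xpredT (fun u (X : n.-tuple T) =>
    \prod_(k < n.+2) F k (nth t [:: s, u & X] k) (nth t [:: s, u & X] k.+1))).
  apply: eq_bigr => u _; rewrite (IHn (fun k => F k.+1)).
  by rewrite big_distrr; apply: eq_bigr => X _; rewrite [RHS]big_ord_recl.
exists (fun X : n.+1.-tuple T => (thead X, [tuple of behead X])) => [[u X]|X] _.
  by congr pair; exact: val_inj.
by rewrite /= -tuple_eta.
Qed.

(** Genuine matrices bring associativity, so that chains can be regrouped and operators moved
    through them. *)
Definition fmx (F : T -> T -> R) : 'M[R]_#|T| :=
  \matrix_(i, j) F (enum_val i) (enum_val j).

Lemma fmxE F s t : fmx F (enum_rank s) (enum_rank t) = F s t.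
Proof. by rewrite mxE !enum_rankK. Qed.

Lemma fmxP (F G : T -> T -> R) : (forall s t, F s t = G s t) <-> fmx F = fmx G.
Proof.
split=> [eqFG|eqFG s t]; last by rewrite -!fmxE eqFG.
by apply/matrixP=> i j; rewrite !mxE.
Qed.

Lemma fmx1 : fmx (fun s t => (s == t)%:R) = 1%:M.
Proof. by apply/matrixP=> i j; rewrite !mxE (inj_eq enum_val_inj). Qed.

Lemma fmxM F G : fmx F *m fmx G = fmx (fun s t => \sum_u F s u * G u t).
Proof.
apply/matrixP=> i j; rewrite !mxE (reindex (@enum_rank T)) /=; last first.
  by apply: onW_bij; exact: enum_rank_bij.
by apply: eq_bigr => u _; rewrite !mxE enum_rankK.
Qed.

Lemma big_fmx n (F : 'I_n -> T -> T -> R) :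
  \big[mulmx/1%:M]_(i < n) fmx (F i) = fmx (chain_sum F).
Proof.
elim: n => [|n IHn] in F *; first by rewrite big_ord0 -fmx1.
by rewrite big_ord_recl IHn fmxM.
Qed.

End Chains.

(** * Minors of whirls *)

Section Bidiagonal.
Variable R : comNzRingType.

Definition mseq0 (T : Type) (N : T -> T -> R) s t : R :=
  if size s == size t then minor_seq N s t else 0.

Lemma mseq0_map (T U : Type) (f : T -> U) (N : U -> U -> R) s t :
  mseq0 N (map f s) (map f t) = mseq0 (fun a b => N (f a) (f b)) s t.
Proof.
by rewrite /mseq0 !size_map; case: eqP => // st; rewrite minor_seq_map.
Qed.

Variables (T : eqType) (N : T -> T -> R).

Lemma eq_mseq0 N' s t : (forall a b, N a b = N' a b) -> mseq0 N s t = mseq0 N' s t.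
Proof.
by move=> eqN; rewrite /mseq0; case: eqP => // st; apply: eq_minor_seq => // a b _ _.
Qed.

Lemma mseq0_row a b s t : (forall b', b' \in t -> N a b' = 0) ->
  mseq0 N (a :: s) (b :: t) = N a b * mseq0 N s t.
Proof.
rewrite /mseq0 /= eqSS => N0; case: eqP => [st|]; last by rewrite mulr0.
rewrite (minor_seqE a N (s := a :: s) (k := (size s).+1)) /= ?st //.
rewrite (expand_det_row _ ord0) big_ord_recl big1 => [|i _].
  rewrite addr0 mxE /cofactor expr0 mul1r (minor_seqE a N (k := size s)) -?st //.
  by congr (_ * \det _); apply/matrixP => i j; rewrite !mxE.
by rewrite mxE /= N0 ?mul0r // mem_nth //; exact: ltn_ord.
Qed.

Lemma mseq0_row0 a s t : (forall b', b' \in t -> N a b' = 0) ->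
  mseq0 N (a :: s) t = 0.
Proof.
case: t => [|b t] N0; first by rewrite /mseq0.
rewrite mseq0_row ?N0 ?mul0r ?mem_head // => b' tb'.
by rewrite N0 // inE tb' orbT.
Qed.

Lemma mseq0_col a b s t : (forall a', a' \in s -> N a' b = 0) ->
  mseq0 N (a :: s) (b :: t) = N a b * mseq0 N s t.
Proof.
rewrite /mseq0 /= eqSS => N0; case: eqP => [st|]; last by rewrite mulr0.
rewrite (minor_seqE a N (s := a :: s) (k := (size s).+1)) /= ?st //.
rewrite (expand_det_col _ ord0) big_ord_recl big1 => [|i _].
  rewrite addr0 mxE /cofactor expr0 mul1r (minor_seqE a N (k := size s)) -?st //.
  by congr (_ * \det _); apply/matrixP => i j; rewrite !mxE.
rewrite mxE /= N0 ?mul0r // mem_nth // st; exact: ltn_ord.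
Qed.

Lemma mseq0_col0 b s t : (forall a', a' \in s -> N a' b = 0) ->
  mseq0 N s (b :: t) = 0.
Proof.
case: s => [|a s] N0; first by rewrite /mseq0.
rewrite mseq0_col ?N0 ?mul0r ?mem_head // => b' tb'.
by rewrite N0 // inE tb' orbT.
Qed.

End Bidiagonal.

Section Transfer.
Variable R : comNzRingType.

(* v and v' tell whether a path occupies a position before and after a whirl,
   g whether one falls out of this position and g' whether one falls into it. *)
Definition vertex_weight (y : R) (v v' g g' : bool) : R :=
  if [&& v, v', ~~ g & ~~ g'] then y else ((v == g) && (v' == g'))%:R.

(* gt: a path leaves at the lowest position; gb: one enters at the highest. *)
Definition transfer m (y : 'I_m -> R) (gt gb : bool) (A B : {set 'I_m}) : R :=
  chain_sum (fun i => vertex_weight (y i) (i \in A) (i \in B)) gt gb.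

Lemma filter_enum_ordS m (P : pred 'I_m.+1) :
  filter P (enum 'I_m.+1) =
  nseq (P ord0) ord0 ++ map (lift ord0) (filter (P \o lift ord0) (enum 'I_m)).
Proof. by rewrite enum_ordSl /= filter_map; case: (P ord0). Qed.

(* For the induction, one more position ord0 is added below the others: it is a
   column exactly when a path falls into it. *)
Lemma mseq0_whirl m (y : 'I_m.+1 -> R) (v v' : pred 'I_m) (g : bool) :
  mseq0 (whirl y) (map (lift ord0) (filter v (enum 'I_m)))
    (nseq g ord0 ++ map (lift ord0) (filter v' (enum 'I_m))) =
  chain_sum (fun i => vertex_weight (y (lift ord0 i)) (v i) (v' i)) g false.
Proof.
elim: m => [|m IHm] in y v v' g *.
  case: (enum _) (size_enum_ord 0) => //= _.
  by case: g; rewrite /mseq0 //= /minor_seq det_mx00.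
rewrite !filter_enum_ordS /= !map_cat !map_nseq big_bool /=.
(* Without the lowest position the matrix is again a whirl, since its entries depend only on
   equality and succession of indices. *)
have {}IHm h : chain_sum (fun i => vertex_weight (y (lift ord0 (lift ord0 i)))
      (v (lift ord0 i)) (v' (lift ord0 i))) h false =
    mseq0 (whirl y)
     (map (lift ord0) (map (lift ord0) (filter (v \o lift ord0) (enum 'I_m))))
     (nseq h (lift ord0 ord0) ++
      map (lift ord0) (map (lift ord0) (filter (v' \o lift ord0) (enum 'I_m)))).
  have -> : nseq h (lift ord0 ord0) = map (lift ord0) (nseq h (@ord0 m)) by case: h.
  rewrite -map_cat mseq0_map.
  rewrite -(IHm (y \o lift ord0) (v \o lift ord0) (v' \o lift ord0)).
  apply: eq_mseq0 => a b; rewrite !mxE /= (inj_eq lift_inj) /bump /=.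
  by rewrite !add1n eqSS.
rewrite !IHm.
have W1 (b : 'I_m) : whirl y (lift ord0 ord0) (lift ord0 (lift ord0 b)) = 0.
  by rewrite !mxE.
(* Column [ord0] can meet only row [lift ord0 ord0], in an entry 1: that row must be present and
   both are expanded away. *)
case: g => /=.
  case: (v ord0) => /=; last first.
    rewrite mseq0_col0 => [|_ /mapP[_ /mapP[i _ ->] ->]]; last by rewrite mxE.
    by rewrite !mul0r addr0.
  rewrite mseq0_col => [|_ /mapP[_ /mapP[i _ ->] ->]]; last by rewrite mxE.
  by rewrite mxE /=; case: (v' ord0); rewrite /= !(mul0r,mul1r,add0r,addr0).
(* Without column [ord0], row [lift ord0 ord0] can only use its diagonal entry. *)
case: (v ord0); last first.
  by case: (v' ord0); rewrite /= !(mul0r,mul1r,add0r,addr0).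
case: (v' ord0) => /=.
  rewrite mseq0_row => [|_ /mapP[_ /mapP[i _ ->] ->]]; last by rewrite W1.
  by rewrite mxE eqxx !(mul0r,mul1r,add0r,addr0).
rewrite mseq0_row0 => [|_ /mapP[_ /mapP[i _ ->] ->]]; last by rewrite W1.
by rewrite !(mul0r,addr0).
Qed.

Lemma minor0_whirl m (y : 'I_m -> R) A B :
  minor0 (whirl y) A B = transfer y false false A B.
Proof.
(* The extra lowest position required by [mseq0_whirl] is here neither a row nor a column, so its
   diagonal value is arbitrary. *)
pose y' j := oapp y 0 (unlift ord0 j).
have := mseq0_whirl y' (mem A) (mem B) false; rewrite cat0s mseq0_map => e.
rewrite /transfer (eq_chain_sum (G := fun i =>
  vertex_weight (y' (lift ord0 i)) (i \in A) (i \in B))) => [|i g g']; last first.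
  by rewrite /y' liftK.
have en (C : {set 'I_m}) : filter (mem C) (enum 'I_m) = enum C.
  by rewrite enumT.
rewrite -e !en /minor0 /mseq0 -!cardE; case: eqP => // AB.
apply: eq_minor_seq => [|i j _ _]; first by rewrite -!cardE.
by rewrite !mxE /y' liftK (inj_eq lift_inj) /= /bump /= !add1n eqSS.
Qed.

End Transfer.

HB.instance Definition _ (R : comNzRingType) (n : nat) :=
  Monoid.isLaw.Build 'M[R]_n 1%:M (@mulmx R n n n)
    (@mulmxA R n n n n) (@mul1mx R n n) (@mulmx1 R n n).

(** * Particle-hole duality *)

Section Duality.
Variable R : comNzRingType.

(** Exchanging the two directions and complementing all edges fixes the vertex of weight [y], whose
    [v] edges are occupied and [g] edges empty, and preserves the equalities [v = g] and
    [v' = g']. *)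
Lemma vertex_weight_dual (y : R) (h h' f f' : bool) :
  vertex_weight y (~~ f) (~~ f') (~~ h) (~~ h') = vertex_weight y h h' f f'.
Proof. by case: h h' f f' => [] [] [] []. Qed.

Lemma vertex_weight_sym (y : R) (v v' g g' : bool) :
  vertex_weight y v' v g' g = vertex_weight y v v' g g'.
Proof. by case: v v' g g' => [] [] [] []. Qed.

(** Both sides sum over the edge states of one [m] by [n] grid. Complementation turns the gaps of
    [I] and [J] into exits and entries at each [p], and the empty sides into fully occupied ones. *)
Lemma transfer_swap m n (X : 'I_m -> 'I_n -> R) (I J : {set 'I_n}) :
  chain_sum (fun i => transfer (X i) false false) I J =
  chain_sum (fun p => transfer (X^~ p) (p \notin I) (p \notin J)) setT setT.
Proof.
rewrite !chain_sumE.
under eq_bigr => h _.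
  rewrite (eq_bigr _ (fun i _ => chain_sumE _ _ _)) bigA_distr_big /=; over.
under [RHS]eq_bigr => V _.
  rewrite (eq_bigr _ (fun i _ => chain_sumE _ _ _)) bigA_distr_big_dep /=; over.
rewrite [RHS]exchange_big /=.
(* [h] holds the edges of one direction, [f] those of the other; [gof] and [Vof] transpose and
   complement them, with inverses [hof] and [fof]. *)
pose gof (h : {ffun 'I_m.+1 -> {set 'I_n}}) : {ffun 'I_n -> {ffun 'I_m.+1 -> bool}} :=
  [ffun p => [ffun i => p \notin h i]].
pose hof (g : {ffun 'I_n -> {ffun 'I_m.+1 -> bool}}) : {ffun 'I_m.+1 -> {set 'I_n}} :=
  [ffun i => [set p | ~~ g p i]].
pose Vof (f : {ffun 'I_m -> {ffun 'I_n.+1 -> bool}}) : {ffun 'I_n.+1 -> {set 'I_m}} :=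
  [ffun p => [set i | ~~ f i p]].
pose fof (V : {ffun 'I_n.+1 -> {set 'I_m}}) : {ffun 'I_m -> {ffun 'I_n.+1 -> bool}} :=
  [ffun i => [ffun p => i \notin V p]].
rewrite [RHS](reindex gof) /=; last first.
  exists hof => [h|g] _.
    by apply/ffunP => i; apply/setP => p; rewrite !(ffunE, inE) negbK.
  by apply/ffunP => p; apply/ffunP => i; rewrite !(ffunE, inE) negbK.
apply: eq_big => [h|h _].
  apply/andP/familyP => [[/eqP <- /eqP <-] p|hIJ].
    by rewrite unfold_in /= !ffunE !eqxx.
  by split; apply/eqP/setP => p; move/(_ p): hIJ; rewrite unfold_in /= !ffunE;
     case/andP=> /eqP/negb_inj h0 /eqP/negb_inj hm; rewrite ?h0 ?hm.
rewrite [RHS](reindex Vof) /=; last first.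
  exists fof => [f|V] _.
    by apply/ffunP => i; apply/ffunP => p; rewrite !(ffunE, inE) negbK.
  by apply/ffunP => p; apply/setP => i; rewrite !(ffunE, inE) negbK.
apply: eq_big => [f|f _].
  apply/ffun_onP/andP => [f0|[/eqP/setP V0 /eqP/setP V1] i].
    by split; apply/eqP/setP => i; have := f0 i; rewrite unfold_in /= !(ffunE, inE);
       case/andP=> /eqP f0i /eqP fni; rewrite ?f0i ?fni.
  have := V0 i; have := V1 i; rewrite !ffunE !inE [_ \in _]unfold_in /=.
  by case: (f i ord0) => // + _; case: (f i ord_max).
rewrite exchange_big /=; apply: eq_bigr => p _; apply: eq_bigr => i _.
by rewrite !(ffunE, inE) vertex_weight_dual.
Qed.

End Duality.

(** * Frozen paths *)

Section ForcedPaths.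
Variable R : comNzRingType.

Lemma forall_ordS n (P : pred 'I_n.+1) :
  [forall i, P i] = P ord0 && [forall i, P (lift ord0 i)].
Proof.
apply/forallP/andP => [Pi|[P0 /forallP PS] i]; first by split=> //; apply/forallP.
by case: (unliftP ord0 i) => [j|] ->.
Qed.

(** An exit forces position 0 to be occupied, and each occupied position below [e] afterwards forces
    the next path to fall: positions 0 to [e] all shift down by one with weight 1. From [e] on, the
    chain continues as if these paths were absent. *)
Lemma chain_sum_exit m (y : 'I_m -> R) (v v' : 'I_m -> bool) gb e : (e < m)%N ->
  (if [forall i : 'I_m, (i < e)%N ==> ~~ v' i] then
     chain_sum (fun i => vertex_weight (y i) (v i) ((i < e)%N || v' i)) true gb
   else 0) =
  (if [forall i : 'I_m, (i <= e)%N ==> v i] then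
     chain_sum (fun i => vertex_weight (y i) ((e < i)%N && v i) (v' i)) false gb
   else 0).
Proof.
elim: e m => [|e IHe] [//|m] in y v v' *.
  move=> _; rewrite forall_ordS /= big_bool /= !forall_ordS.
  have -> : [forall i : 'I_m, (bump 0 i <= 0)%N ==> v (lift ord0 i)] by apply/forallP.
  rewrite andbT big_bool /=.
  by case: (v ord0); case: (v' ord0); rewrite /= !(mul0r,mul1r,add0r,addr0).
rewrite ltnS => lt_em; rewrite !forall_ordS /= !big_bool /=.
have := IHe m (y \o lift ord0) (v \o lift ord0) (v' \o lift ord0) lt_em.
case: m lt_em => [//|m] lt_em in y v v' *.
case: (v' ord0) => /=.
  move=> _; rewrite mul0r addr0 mul1r big1 => [|u _]; first by case: ifP.
  by rewrite mul0r.
by case: (v ord0) => /=; rewrite !(mul0r,mul1r,add0r,addr0) //; case: ifP.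
Qed.

Definition initial (m e : nat) : {set 'I_m} := [set i : 'I_m | (i < e)%N].

Definition exit_op m e (A B : {set 'I_m}) : R :=
  ((initial m e \subset A) && (B == A :\: initial m e))%:R.

(** As the removal moves to the left of a step, it absorbs the exit of that step. Since [exit_op]
    determines [C], each sum has at most one nonzero term, and [chain_sum_exit] compares the two. *)
Lemma transfer_exit m (y : 'I_m -> R) gb e A B : (e < m)%N ->
  \sum_C transfer y true gb A C * exit_op e C B =
  \sum_C exit_op e.+1 A C * transfer y false gb C B.
Proof.
move=> lt_em.
have -> : \sum_C transfer y true gb A C * exit_op e C B =
    if [forall i : 'I_m, (i < e)%N ==> (i \notin B)] then
      transfer y true gb A (initial m e :|: B) else 0.
  case: ifPn => [/forallP eB|]; last rewrite negb_forall => /existsP[k].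
    rewrite (bigD1 (initial m e :|: B)) //= big1 ?addr0 => [|C neqC].
      rewrite /exit_op subsetUl setDUl setDv set0U; case: eqP => [|[]].
        by rewrite mulr1.
      apply/setP => i; have := eB i; rewrite !inE.
      by case: (i < e)%N => //= /negPf.
    rewrite /exit_op; case: andP => [[eC /eqP BE]|_]; last by rewrite mulr0.
    by rewrite BE setDE setUIr setUCr setIT (setUidPr eC) eqxx in neqC.
  rewrite negb_imply negbK => /andP[ie iB]; rewrite big1 // => C _.
  rewrite /exit_op; case: andP => [[_ /eqP BE]|_]; last by rewrite mulr0.
  by rewrite BE !inE ie in iB.
have -> : \sum_C exit_op e.+1 A C * transfer y false gb C B =
    if [forall i : 'I_m, (i <= e)%N ==> (i \in A)] then
      transfer y false gb (A :\: initial m e.+1) B else 0.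
  case: ifPn => [/forallP eA|]; last rewrite negb_forall => /existsP[k].
    rewrite (bigD1 (A :\: initial m e.+1)) //= big1 ?addr0 => [|C neqC].
      rewrite /exit_op eqxx andbT; case: subsetP => [|[]]; first by rewrite mul1r.
      by move=> i; rewrite inE => ie; exact: (implyP (eA i)).
    by rewrite /exit_op (negPf neqC) andbF mul0r.
  rewrite negb_imply => /andP[ie iA]; rewrite big1 // => C _.
  rewrite /exit_op; case: subsetP => [eA|_]; last by rewrite mul0r.
  by rewrite eA ?inE in iA.
have := chain_sum_exit y (mem A) (mem B) gb lt_em.
rewrite /transfer => e1; apply: etrans (etrans e1 _).
  by congr (if _ then _ else _); apply: eq_chain_sum => i g g'; rewrite !inE.
congr (if _ then _ else _); apply: eq_chain_sum => i g g'.
by rewrite !inE ltnS -ltnNge.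
Qed.

Definition rev_set m (A : {set 'I_m}) : {set 'I_m} := [set i | rev_ord i \in A].

Lemma rev_setK m : involutive (@rev_set m).
Proof. by move=> A; apply/setP => i; rewrite !inE rev_ordK. Qed.

(** Reversing the positions exchanges the [g] edges of each vertex, and by [vertex_weight_sym] this
    must be paired with an exchange of [A] and [B]: a half-turn of the grid. *)
Lemma transfer_rev m (y : 'I_m -> R) gt gb A B :
  transfer y gt gb A B =
  transfer (y \o @rev_ord m) gb gt (rev_set B) (rev_set A).
Proof.
pose r (c : {ffun 'I_m.+1 -> bool}) : {ffun 'I_m.+1 -> bool} :=
  [ffun i => c (rev_ord i)].
rewrite /transfer !chain_sumE (reindex r) /=; last first.
  by exists r => c _; apply/ffunP => i; rewrite !ffunE rev_ordK.
have r0 : rev_ord ord0 = ord_max :> 'I_m.+1 by apply: val_inj; rewrite /= subn1.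
have r1 : rev_ord ord_max = ord0 :> 'I_m.+1 by apply: val_inj; rewrite /= subnn.
apply: eq_big => [c|c _]; first by rewrite !ffunE r0 r1 andbC.
rewrite (reindex_inj rev_ord_inj); apply: eq_bigr => i _.
rewrite !inE !ffunE /= vertex_weight_sym.
congr (vertex_weight _ _ _ (c _) (c _)); apply: val_inj => /=; rewrite /bump;
  have := ltn_ord i; lia.
Qed.

(** Defined as the half-turn of [exit_op], so that [transfer_entry] follows from [transfer_exit];
    [entry_opE] makes it explicit. *)
Definition entry_op m e (A B : {set 'I_m}) : R := exit_op e (rev_set B) (rev_set A).

Lemma transfer_entry m (y : 'I_m -> R) gt e A B : (e < m)%N ->
  \sum_C entry_op e A C * transfer y gt true C B =
  \sum_C transfer y gt false A C * entry_op e.+1 C B.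
Proof.
move=> lt_em; have revI := can_inj (@rev_setK m).
rewrite (reindex_inj revI) [RHS](reindex_inj revI) /entry_op.
under eq_bigr do rewrite rev_setK mulrC transfer_rev rev_setK.
under [RHS]eq_bigr do rewrite rev_setK mulrC transfer_rev rev_setK.
exact: transfer_exit.
Qed.

Lemma exit_op0 m (A B : {set 'I_m}) : exit_op 0 A B = (A == B)%:R.
Proof.
rewrite /exit_op; have -> : initial m 0 = set0 by apply/setP => i; rewrite !inE.
by rewrite sub0set setD0 eq_sym.
Qed.

Lemma entry_op0 m (A B : {set 'I_m}) : entry_op 0 A B = (A == B)%:R.
Proof. by rewrite /entry_op exit_op0 (inj_eq (can_inj (@rev_setK m))) eq_sym. Qed.

(** Exits fill the first [e] steps. Once those of the tail are collected, [transfer_exit] carries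
    the removal across the first step and adds its exit. *)
Lemma block_exit m n (Y : nat -> 'I_m -> R) (t : nat -> bool) e :
  (e <= n)%N -> (e <= m)%N ->
  \big[mulmx/1%:M]_(j < n) fmx (transfer (Y j) (j < e)%N (t j)) =
  fmx (@exit_op m e) *m \big[mulmx/1%:M]_(j < n) fmx (transfer (Y j) false (t j)).
Proof.
have e0 : fmx (@exit_op m 0) = 1%:M.
  by rewrite -fmx1; apply/fmxP => A B; exact: exit_op0.
elim: n => [|n IHn] in Y t e *.
  by rewrite leqn0 => /eqP-> _; rewrite e0 mul1mx !big_ord0.
case: e => [|e]; first by move=> *; rewrite e0 mul1mx.
rewrite ltnS => le_en lt_em; rewrite !big_ord_recl.
rewrite -/(transfer (Y 0%N) _ _).
have := IHn (fun j => Y j.+1) (fun j => t j.+1) e le_en (ltnW lt_em).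
move=> /= ->; rewrite !mulmxA; congr (_ *m _); rewrite !fmxM; apply/fmxP => A B.
exact: transfer_exit.
Qed.

(** Entries fill the steps from [b] on, and are collected on the right by peeling off the last
    step. *)
Lemma block_entry m n (Y : nat -> 'I_m -> R) (t : nat -> bool) b :
  (n - b <= m)%N ->
  \big[mulmx/1%:M]_(j < n) fmx (transfer (Y j) (t j) (b <= j)%N) =
  \big[mulmx/1%:M]_(j < n) fmx (transfer (Y j) (t j) false) *m
  fmx (@entry_op m (n - b)).
Proof.
have e0 : fmx (@entry_op m 0) = 1%:M.
  by rewrite -fmx1; apply/fmxP => A B; exact: entry_op0.
elim: n => [|n IHn]; first by rewrite sub0n e0 mulmx1 !big_ord0.
case: (leqP b n) => [le_bn|lt_nb].
  rewrite subSn // => lt_m.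
  rewrite !big_ord_recr /= IHn ?(ltnW lt_m) // le_bn.
  rewrite -!mulmxA; congr (_ *m _); rewrite !fmxM; apply/fmxP => A B.
  exact: transfer_entry.
(* With [n < b], no step of the block has an entry. *)
have -> : (n.+1 - b = 0)%N by lia.
move=> _; rewrite e0 mulmx1; apply: eq_bigr => j _.
by rewrite leqNgt (leq_trans (ltn_ord j)).
Qed.

End ForcedPaths.

(** * Minors of products of whirls *)

Section CompoundProduct.
Variable R : comNzRingType.

Lemma minor0_1 m (A B : {set 'I_m}) : minor0 (1%:M : 'M[R]_m) A B = (A == B)%:R.
Proof.
rewrite /minor0; case: ifP => [/eqP AB|AB]; last by have [eAB|//] := eqVneq A B; rewrite eAB eqxx in AB.
rewrite /minorM; have [<-|neqAB] := eqVneq A B.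
  case: (posnP #|A|) => [A0|].
    rewrite /minor_seq; have -> : enum A = [::] by apply/nilP; rewrite /nilp -cardE A0.
    by rewrite det_mx00.
  case/card_gt0P => i0 _; rewrite (minor_seqE i0 _ (k := #|A|)) -?cardE //.
  rewrite mulr1n -[RHS](det1 R #|A|); congr (\det _); apply/matrixP => i j; rewrite !mxE.
  by rewrite nth_uniq ?enum_uniq -?cardE.
(* Distinct sets of equal size leave an element of [A] outside [B], hence a zero row. *)
have /subsetPn[i iA iB] : ~~ (A \subset B).
  by apply: contra neqAB => sAB; rewrite eqEcard sAB AB leqnn.
rewrite (minor_seqE i _ (k := #|A|)) -?cardE //.
have ltA : (index i (enum A) < #|A|)%N by rewrite cardE index_mem mem_enum.
rewrite (expand_det_row _ (Ordinal ltA)) big1 // => j _.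
rewrite !mxE /= nth_index ?mem_enum //; case: eqP => [e|]; last by rewrite mul0r.
by rewrite e -mem_enum mem_nth // -cardE -AB in iB.
Qed.

Lemma fmx_minor0_prod m n (N : 'I_n -> 'M[R]_m) :
  fmx (minor0 (\big[mulmx/1%:M]_(j < n) N j)) =
  \big[mulmx/1%:M]_(j < n) fmx (minor0 (N j)).
Proof.
apply: (big_morph (fun N : 'M[R]_m => fmx (minor0 N))) => [P Q|].
  by rewrite fmxM; apply/fmxP => A B; exact: minor0_mul.
by rewrite -fmx1; apply/fmxP => A B; exact: minor0_1.
Qed.

Lemma fmx_minor0_whirl m (y : 'I_m -> R) :
  fmx (minor0 (whirl y)) = fmx (transfer y false false).
Proof. by apply/fmxP => A B; exact: minor0_whirl. Qed.

Lemma minor0_whirl_prod m n (Y : 'I_m -> 'I_n -> R) (I J : {set 'I_n}) :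
  minor0 (\big[mulmx/1%:M]_(i < m) whirl (Y i)) I J =
  chain_sum (fun i => transfer (Y i) false false) I J.
Proof.
rewrite -fmxE fmx_minor0_prod -[RHS]fmxE -big_fmx.
by congr ((_ : 'M__) _ _); apply: eq_bigr => i _; exact: fmx_minor0_whirl.
Qed.

End CompoundProduct.

(** * Factorisation into blocks *)

Section Assembly.
Variable R : comNzRingType.

(** The shifted brackets join the entries that end a block to the exits that open the next one. *)
Lemma regroup q d (P Q : nat -> 'M[R]_q) :
  \big[mulmx/1%:M]_(k < d.+1) (P k *m Q k) =
  P 0%N *m \big[mulmx/1%:M]_(k < d) (Q k *m P k.+1) *m Q d.
Proof.
elim: d => [|d IHd]; first by rewrite big_ord1 big_ord0 mulmx1.
by rewrite big_ord_recr IHd [in RHS]big_ord_recr /= !mulmxA.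
Qed.

Variables (m n d : nat) (a b : nat -> nat) (Y : nat -> 'I_m -> R).
Hypothesis Yn : forall k j, Y (j + k * n) = Y j.
Hypothesis hn : (0 < n)%N.
Hypothesis ha' : forall k, (k <= d)%N -> (n - a k <= m)%N.
Hypothesis hb' : forall k, (k <= d)%N -> (n - b k <= m)%N.
Hypothesis hX : forall k, (k < d)%N -> (n - a k.+1 <= m - (n - b k))%N.

Let N := (d.+1 * n)%N.
Let M := \big[mulmx/1%:M]_(j < n) whirl (Y j).

(* The position p : 'I_N stands for the integer p + 1. *)
Definition rows_of : {set 'I_N} := [set p : 'I_N | (n - a (p %/ n) <= p %% n)%N].
Definition cols_of : {set 'I_N} := [set p : 'I_N | (p %% n < b (p %/ n))%N].

(** After [transfer_swap] there are [N] steps, starting and ending with all positions occupied. Cut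
    into blocks of [n], they repeat the same whirls since [Y] is periodic, with exits in the first
    [n - a k] steps and entries in the last [n - b k]. *)
Lemma minor0_blocks :
  minor0 (\big[mulmx/1%:M]_(i < m) whirl (fun p : 'I_N => Y p i)) rows_of cols_of =
  (\big[mulmx/1%:M]_(k < d.+1)
     (fmx (exit_op R (n - a k)) *m (fmx (minor0 M) *m fmx (entry_op R (n - b k)))))
  (enum_rank setT) (enum_rank setT).
Proof.
rewrite minor0_whirl_prod transfer_swap -[LHS]fmxE -big_fmx.
congr ((_ : 'M__) _ _).
pose G p := fmx (transfer (Y p) (p %% n < n - a (p %/ n))%N (b (p %/ n) <= p %% n)%N).
rewrite (eq_bigr (fun p : 'I_N => G p)); last first.
  by move=> p _; rewrite !inE -ltnNge -leqNgt.
rewrite -(big_mkord xpredT G) big_nat_mul big_mkord; apply: eq_bigr => k _.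
rewrite mulSn -{1}[(k * n)%N]add0n big_addn addnK big_mkord.
rewrite (eq_bigr (fun j : 'I_n => fmx (transfer (Y j) (j < n - a k)%N (b k <= j)%N))).
  have lekd : (k <= d)%N by rewrite -ltnS.
  rewrite (block_exit Y (fun j => b k <= j)%N) ?leq_subr ?ha' //; congr (_ *m _).
  rewrite (block_entry Y (fun=> false)) ?hb' //; congr (_ *m _).
  by rewrite fmx_minor0_prod; apply: eq_bigr => j _; rewrite fmx_minor0_whirl.
move=> j _; rewrite /G Yn addnC modnMDl divnMDl //.
by rewrite modn_small // divn_small // addn0.
Qed.

Definition init_set k : {set 'I_m} := itvM m 1 (n - a_ext n d a k).
Definition top_set k : {set 'I_m} := itvM m (m - (n - b_prev n b k) + 1) m.
Definition mid_set k : {set 'I_m} :=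
  itvM m (n - a k.+1 + 1) (m - (n - b k)).

Lemma a_ext_le k : (n - a_ext n d a k <= m)%N.
Proof. by rewrite /a_ext; case: ifP => [/ha'|_] //; rewrite subnn. Qed.

Lemma b_prev_le k : (k <= d.+1)%N -> (n - b_prev n b k <= m)%N.
Proof. by case: k => [|k] /=; [rewrite subnn | exact: hb']. Qed.

Lemma initialE e : initial m e = itvM m 1 e.
Proof. by apply/setP => i; rewrite !inE. Qed.

Lemma entry_opE c (A B : {set 'I_m}) : (c <= m)%N ->
  entry_op R c A B =
  ([disjoint A & itvM m (m - c + 1) m] && (B == A :|: itvM m (m - c + 1) m))%:R.
Proof.
move=> le_cm; set top := itvM _ _ _.
have topE : rev_set (initial m c) = top.
  by apply/setP => i; rewrite !inE /=; have := ltn_ord i; lia.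
have revS (C D : {set 'I_m}) : (C \subset rev_set D) = (rev_set C \subset D).
  apply/subsetP/subsetP => sCD i iC; last by rewrite inE sCD // inE rev_ordK.
  by have := sCD (rev_ord i); rewrite !inE rev_ordK; apply; rewrite inE in iC.
have revD (C D : {set 'I_m}) : rev_set (C :\: D) = rev_set C :\: rev_set D.
  by apply/setP => i; rewrite !inE.
rewrite /entry_op /exit_op revS topE; congr (_%:R); congr nat_of_bool.
rewrite -(can_eq (@rev_setK m)) rev_setK revD topE rev_setK.
apply/andP/andP => [[sub /eqP->]|[disj /eqP->]].
  split; first by rewrite disjoints_subset setDE subsetIr.
  apply/eqP/setP => i; have := subsetP sub i; rewrite in_setU in_setD.
  by case: (i \in top) => [->|_]; rewrite ?orbT ?orbF.
rewrite subsetUr setDUl setDv setU0; split=> //.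
by rewrite eq_sym; apply/eqP/setDidPl.
Qed.

(** [X] is the state [S] without its frozen lowest positions. The guard restricts the range
    condition to [X_1, ..., X_d]; the last set [X_(d+1)] is prescribed. *)
Definition add_init k (S X : {set 'I_m}) : R :=
  (((k < d)%N ==> (X \subset mid_set k)) && (S == init_set k.+1 :|: X))%:R.

Definition add_top k (X S : {set 'I_m}) : R := (S == X :|: top_set k)%:R.

(** Entries fill [top] and exits empty [ini]. By [hX] these are disjoint, so what both operations
    leave alone is a subset of the middle range, [X = A :\: ini]. *)
Lemma entry_exit k : (k < d)%N ->
  fmx (entry_op R (n - b k)) *m fmx (exit_op R (n - a k.+1)) =
  fmx (add_init k) *m fmx (add_top k.+1).
Proof.
move=> lt_kd; rewrite !fmxM; apply/fmxP => A B.
set top := top_set k.+1; set ini := init_set k.+1.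
have initialE' : initial m (n - a k.+1) = ini.
  by rewrite initialE /ini /init_set /a_ext lt_kd.
have le_c : (n - b k <= m)%N by rewrite hb' // ltnW.
have itE : ini :&: top = set0.
  apply/setP => i; rewrite !inE /a_ext lt_kd /b_prev.
  by have := hX lt_kd; have := ltn_ord i; lia.
have midE : mid_set k = ~: (ini :|: top).
  apply/setP => i; rewrite !inE /a_ext lt_kd /b_prev.
  by have := hX lt_kd; have := ltn_ord i; lia.
(* Both products are the indicator of this condition. *)
transitivity (([disjoint A & top] && (ini \subset A) &&
               (B == (A :\: ini) :|: top))%:R : R).
  have tD : (A :|: top) :\: ini = (A :\: ini) :|: top.
    by rewrite setDUl; congr (_ :|: _); apply/setDidPl; rewrite -setI_eq0 setIC itE.
  have sA : (ini \subset A :|: top) = (ini \subset A).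
    by rewrite setUC -subDset (setDidPl _) // -setI_eq0 itE.
  rewrite (bigD1 (A :|: top)) //= big1 ?addr0 => [|C neqC].
    rewrite entry_opE // -/top eqxx andbT /exit_op initialE' tD sA.
    by rewrite -natrM mulnb andbA.
  by rewrite entry_opE // -/top (negPf neqC) andbF mul0r.
rewrite (bigD1 (A :\: ini)) //= [X in _ + X]big1 ?addr0 => [|X neqX].
  rewrite /add_init /add_top lt_kd -/top -/ini midE -natrM mulnb /=.
  congr (_%:R); congr nat_of_bool; congr (_ && _); congr (_ && _).
    rewrite setCU subsetI [A :\: ini \subset ~: ini]subsetDr /= subDset.
    by rewrite (setUidPr _) ?disjoints_subset // -disjoints_subset -setI_eq0 itE.
  apply/subsetP/eqP => [sA|-> i]; last by rewrite in_setU => ->.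
  by apply/setP => i; have := sA i; rewrite in_setU in_setD; case: (i \in ini) => // ->.
rewrite /add_init /add_top lt_kd -/ini midE /=.
case: andP => [[sX /eqP eA]|_]; last by rewrite mul0r.
case/eqP: neqX; rewrite eA setDUl setDv set0U; apply/esym/setDidPl.
by rewrite disjoints_subset (subset_trans sX) // setCS subsetUl.
Qed.

(** At the start all positions are occupied, and [b_(-1) = n] makes [top_set 0] empty. *)
Lemma exit_full B :
  exit_op R (n - a 0) setT B = add_top 0 (itvM m (n - a 0 + 1) m) B.
Proof.
rewrite /exit_op /add_top subsetT; congr ((_ == _)%:R : R).
by apply/setP => i; rewrite !inE /= subnn; have := ltn_ord i; lia.
Qed.

(** At the end, [a_(d+1) = n] makes [init_set d.+1] empty. *)
Lemma entry_full A :
  entry_op R (n - b d) A setT = add_init d A (itvM m 1 (m - (n - b d))).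
Proof.
rewrite entry_opE ?hb' // /add_init ltnn /=; congr (_%:R); congr nat_of_bool.
apply/andP/eqP => [[dA /eqP/setP eA]|->].
  apply/setP => i; have := eA i; rewrite disjoints_subset in dA.
  have := subsetP dA i; rewrite !inE /a_ext ltnn subnn.
  have := ltn_ord i; have := hb' (leqnn d); case: (i \in A); lia.
split; first rewrite disjoints_subset; last (rewrite eq_sym; apply/eqP/setP => i).
  by apply/subsetP => i; rewrite !inE /a_ext ltnn subnn; lia.
rewrite !inE /a_ext ltnn subnn; have := ltn_ord i; lia.
Qed.

(** The clauses of [admissible] are built into the weight: the guard is the inclusion, and [minor0]
    vanishes when the cardinality condition fails. *)
Definition block_weight k (X X' : {set 'I_m}) : R :=
  if (k < d)%N ==> (X' \subset mid_set k) then
    minor0 M (X :|: top_set k) (init_set k.+1 :|: X') else 0.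

Lemma block_weightE k :
  fmx (add_top k) *m (fmx (minor0 M) *m fmx (add_init k)) = fmx (block_weight k).
Proof.
rewrite !fmxM; apply/fmxP => X X'.
rewrite (bigD1 (X :|: top_set k)) //= [X in _ + X]big1 ?addr0 => [|S neqS]; last first.
  by rewrite /add_top (negPf neqS) mul0r.
rewrite /add_top eqxx mul1r.
rewrite (bigD1 (init_set k.+1 :|: X')) //= [X in _ + X]big1 ?addr0 => [|S neqS]; last first.
  by rewrite /add_init (negPf neqS) andbF mulr0.
by rewrite /add_init /block_weight eqxx andbT; case: (_ ==> _); rewrite (mulr1, mulr0).
Qed.

(** Regrouped around the block boundaries, the two products have the same inner factors by
    [entry_exit]. *)
Lemma minor0_tuples :
  minor0 (\big[mulmx/1%:M]_(i < m) whirl (fun p : 'I_N => Y p i)) rows_of cols_of =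
  \sum_(X : d.-tuple {set 'I_m}) \prod_(k < d.+1)
     block_weight k (X_ext n a b X k) (X_ext n a b X k.+1).
Proof.
rewrite minor0_blocks.
rewrite -[RHS](chain_sum_tuple d block_weight (itvM m (n - a 0 + 1) m)
  (itvM m 1 (m - (n - b d)))) -[RHS]fmxE -big_fmx.
pose P k := fmx (exit_op R (n - a k)) : 'M_#|{set 'I_m}|.
pose Q k := fmx (minor0 M) *m fmx (entry_op R (n - b k)).
pose P' k := fmx (add_top k).
pose Q' k := fmx (minor0 M) *m fmx (add_init k).
rewrite [in RHS](eq_bigr (fun k : 'I_d.+1 => P' k *m Q' k)); last first.
  by move=> k _; rewrite block_weightE.
rewrite (regroup _ P Q) (regroup _ P' Q').
rewrite (eq_bigr (fun k : 'I_d => Q' k *m P' k.+1)); last first.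
  by move=> k _; rewrite -!mulmxA entry_exit.
set C := \big[_/_]_(_ < d) _; rewrite /Q /Q' !mulmxA.
rewrite -!(mulmxA _ C); move: (C *m _) => K.
(* Only one row of the first factor and one column of the last are involved; [exit_full] and
   [entry_full] compare them. *)
rewrite mxE [RHS]mxE; apply: eq_bigr => j _; congr (_ * _).
  rewrite mxE [RHS]mxE; apply: eq_bigr => l _; congr (_ * _).
  by rewrite /P /P' !mxE !enum_rankK exit_full.
by rewrite !mxE !enum_rankK entry_full.
Qed.

Lemma card_itvM lo hi : #|itvM m lo hi| = (minn hi m - lo.-1)%N.
Proof.
rewrite -sum1_card (eq_bigl (fun i : 'I_m => lo <= i.+1 <= hi)%N); last first.
  by move=> i; rewrite inE.
rewrite big_mkcond; elim: (m) => [|q IHq]; first by rewrite big_ord0 minn0.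
by rewrite big_ord_recr /= IHq; case: ifP; lia.
Qed.

Lemma card_rowset (X : d.-tuple {set 'I_m}) k :
  (forall j, (j < d)%N -> X_ext n a b X j.+1 \subset mid_set j) -> (k <= d)%N ->
  #|X_ext n a b X k :|: top_set k| = (#|X_ext n a b X k| + (n - b_prev n b k))%N.
Proof.
move=> sub le_kd; rewrite cardsU (_ : _ :&: _ = set0) ?cards0 ?subn0.
  by rewrite card_itvM; have := b_prev_le (leqW le_kd); lia.
apply/eqP; rewrite setI_eq0 disjoints_subset; case: k le_kd => [|k] lt_kd.
  by apply/subsetP => i _; rewrite !inE /= subnn; have := ltn_ord i; lia.
by apply: subset_trans (sub _ lt_kd) _; apply/subsetP => i; rewrite !inE /=; lia.
Qed.

Lemma card_colset (X : d.-tuple {set 'I_m}) k :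
  (forall j, (j < d)%N -> X_ext n a b X j.+1 \subset mid_set j) ->
  #|init_set k.+1 :|: X_ext n a b X k.+1| =
  (n - a_ext n d a k.+1 + #|X_ext n a b X k.+1|)%N.
Proof.
move=> sub; rewrite cardsU (_ : _ :&: _ = set0) ?cards0 ?subn0.
  by rewrite card_itvM; have := a_ext_le k.+1; lia.
apply/eqP; rewrite setIC setI_eq0 disjoints_subset; case: (ltnP k d) => [lt_kd|le_dk].
  apply: subset_trans (sub _ lt_kd) _; apply/subsetP => i; rewrite !inE /a_ext lt_kd; lia.
by apply/subsetP => i _; rewrite !inE /a_ext (ltnNge k) le_dk subnn; lia.
Qed.

Lemma block_weight_admissible (X : d.-tuple {set 'I_m}) :
  \prod_(k < d.+1) block_weight k (X_ext n a b X k) (X_ext n a b X k.+1) =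
  if admissible n a b X then
    \prod_(k < d.+1) minorM M (rowset n a b X k) (colset n a b X k) else 0.
Proof.
rewrite /admissible.
have [/forallP sub|/forallPn [k nsub]] /= := boolP [forall k : 'I_d,
    X_ext n a b X k.+1 \subset itvM m (n - a k.+1 + 1) (m - (n - b k))]; last first.
  rewrite (bigD1 (widen_ord (leqnSn d) k)) //= /block_weight.
  by rewrite (ltn_ord k) /= (negPf nsub) mul0r.
have {}sub j (lt_jd : (j < d)%N) : X_ext n a b X j.+1 \subset mid_set j.
  exact: (sub (Ordinal lt_jd)).
have le_d (k : 'I_d.+1) : (k <= d)%N by rewrite -ltnS.
case: ifPn => [/forallP card|/forallPn[k card]].
  apply: eq_bigr => k _; rewrite /block_weight /minor0 card_rowset // card_colset //.
  by rewrite (card k) ifT //; apply/implyP; exact: sub.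
rewrite (bigD1 k) //= /block_weight /minor0 card_rowset // card_colset //.
by rewrite (negPf card) if_same mul0r.
Qed.

(** The hypothesis counts the positions in each block, min(a_k, n) and min(b_k, n), the former
    through truncated subtraction. *)
Lemma card_rows_cols :
  (\sum_(k < d.+1) (n - (n - a k)) = \sum_(k < d.+1) minn (b k) n)%N ->
  #|rows_of| = #|cols_of|.
Proof.
have cardN (P : nat -> nat -> bool) :
    #|[set p : 'I_N | P (p %/ n)%N (p %% n)%N]| = (\sum_(k < d.+1) \sum_(j < n) P k j)%N.
  rewrite -sum1_card (eq_bigl (fun p : 'I_N => P (p %/ n)%N (p %% n)%N)); last first.
    by move=> p; rewrite inE.
  rewrite big_mkcond -(big_mkord xpredT (fun p => if P (p %/ n)%N (p %% n)%N then 1 else 0)%N).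
  rewrite big_nat_mul big_mkord; apply: eq_bigr => k _.
  rewrite mulSn -{1}[(k * n)%N]add0n big_addn addnK big_mkord; apply: eq_bigr => j _.
  by rewrite addnC modnMDl divnMDl // modn_small // divn_small // addn0; case: (P _ _).
rewrite /rows_of /cols_of (cardN (fun k j => n - a k <= j)%N) (cardN (fun k j => j < b k)%N).
have sum_ge q e : (\sum_(j < q) (e <= j) = q - e)%N.
  by elim: q => [|q IHq]; rewrite ?big_ord0 // big_ord_recr /= IHq; lia.
have sum_lt q e : (\sum_(j < q) (j < e) = minn e q)%N.
  by elim: q => [|q IHq]; rewrite ?big_ord0 ?minn0 // big_ord_recr /= IHq; lia.
by move=> eq_ab; under eq_bigr do rewrite sum_ge; under [RHS]eq_bigr do rewrite sum_lt.
Qed.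

End Assembly.

(** * Loop elementary symmetric functions *)

Section LoopMatrix.
Variables (R : comNzRingType) (m n : nat) (x : 'I_m -> 'I_n -> R).
Hypothesis hn : (0 < n)%N.

Definition periodic_var (p : nat) (i : 'I_m) : R := x i (Ordinal (ltn_pmod p hn)).

Lemma periodic_varD k j : periodic_var (j + k * n) = periodic_var j.
Proof.
by rewrite /periodic_var (_ : Ordinal _ = Ordinal (ltn_pmod j hn)) //;
   apply: val_inj => /=; rewrite addnC modnMDl.
Qed.

(** The shift by [i] in the superscript cancels the one in the definition of x_i^(r). *)
Lemma loop_varE (p : nat) (i : 'I_m) :
  loop_var x (p.+1%:Z + i%:Z) i = periodic_var p i.
Proof.
rewrite /loop_var /periodic_var.
have eqr : p.+1%:Z + i%:Z - i.+1%:Z + 1 = p.+1%:Z by lia.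
have modE (j : nat) : (j.+1%:Z == p.+1%:Z %[mod n])%Z = (j == p %[mod n])%N.
  by rewrite !modz_nat eqz_nat -[j.+1]addn1 -[p.+1]addn1 eqn_modDr.
case: pickP => [j|/(_ (Ordinal (ltn_pmod p hn)))]; last by rewrite eqr modE /= modn_mod eqxx.
rewrite eqr modE modn_small // => /eqP jp; congr (x i _); exact: val_inj.
Qed.

(** The loop elementary function by recursion on the available indices: the superscript advances
    only when an index is taken. *)
Fixpoint esum (l : seq 'I_m) (k : nat) (r : int) : R :=
  match l, k with
  | _, 0%N => 1
  | [::], _ => 0
  | i :: l', k'.+1 => loop_var x r i * esum l' k' (r + 1) + esum l' k'.+1 r
  end.

Lemma esum0 l r : esum l 0 r = 1.
Proof. by case: l. Qed.

Lemma esum_gt l k r : (size l < k)%N -> esum l k r = 0.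
Proof.
elim: l k r => [|i l IHl] [|k] r //=; rewrite ltnS => lt_lk.
by rewrite !IHl ?mulr0 ?addr0 // ltnW.
Qed.

(** Tuples are split according to whether they start with the head of [l]. *)
Lemma sum_subseq l k r : uniq l ->
  \sum_(t : k.-tuple 'I_m | subseq t l)
     \prod_(s < k) loop_var x (r + s%:Z) (tnth t s) = esum l k r.
Proof.
elim: l k r => [|i l IHl] [|k] r Ul.
- rewrite (big_pred1 [tuple]) => [|t]; first by rewrite big_ord0.
  by rewrite (tuple0 t); apply/idP/eqP => // _; exact: sub0seq.
- by rewrite big1 // => t; case/tupleP: t.
- rewrite (big_pred1 [tuple]) => [|t]; first by rewrite big_ord0.
  by rewrite (tuple0 t); apply/idP/eqP => // _; exact: sub0seq.
have /andP[il {}Ul] : (i \notin l) && uniq l by [].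
rewrite (bigID (fun t : k.+1.-tuple 'I_m => thead t == i)) /=; congr (_ + _).
  rewrite -IHl // big_distrr /=.
  rewrite (reindex_onto (fun t : k.-tuple 'I_m => [tuple of i :: t])
     (fun t : k.+1.-tuple 'I_m => [tuple of behead t])) /=; last first.
    by move=> t /andP[_ /eqP <-]; rewrite -tuple_eta.
  apply: eq_big => [t|t _].
    rewrite theadE eqxx andbT (_ : _ == t) ?andbT //.
    by apply/eqP; exact: val_inj.
  rewrite big_ord_recl addr0 tnth0; congr (_ * _); apply: eq_bigr => s _.
  by rewrite tnthS; congr (loop_var x _ _); rewrite lift0; lia.
rewrite -IHl //; apply: eq_bigl => t; case/tupleP: t => u t.
rewrite theadE /=; case: (eqVneq u i) => [->|]; last by rewrite andbT.
rewrite andbF; apply/esym/negbTE; apply: contra il => /mem_subseq; apply.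
exact: mem_head.
Qed.

Lemma sorted_ltn_subseq (t : seq 'I_m) :
  sorted ltn (map val t) = subseq t (enum 'I_m).
Proof.
rewrite sorted_map; pose r := relpre (@nat_of_ord m) ltn.
have r_trans : transitive r by move=> j i k; exact: ltn_trans.
have r_enum : sorted r (enum 'I_m) by rewrite -sorted_map val_enum_ord iota_ltn_sorted.
apply/idP/idP => [t_sorted|sub]; last exact: subseq_sorted sub r_enum.
rewrite (_ : t = filter (mem t) (enum 'I_m)) ?filter_subseq //.
apply: (irr_sorted_eq r_trans) => // [i||i]; first exact: ltnn.
  exact: sorted_filter.
by rewrite mem_filter mem_enum andbT.
Qed.

Lemma loopE_esum (k : nat) r : loopE x k%:Z r = esum (enum 'I_m) k r.
Proof.
by rewrite -sum_subseq ?enum_uniq //; apply: eq_bigl => t; rewrite sorted_ltn_subseq.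
Qed.

Definition esumZ l (k : int) r : R := if k is Posz k' then esum l k' r else 0.

(** Row [p] of the first whirl either stays at [p], taking the variable of the head of [l], or moves
    to [p - 1] without a variable: this is the recursion of [esum]. As [s] grows by one, the
    superscript advances in the first case and is unchanged in the second. *)
Lemma whirl_prod_esum N (l : seq 'I_m) (s : nat) (p q : 'I_N) :
  map val l = iota s (size l) ->
  (\big[mulmx/1%:M]_(i <- l) whirl (fun p : 'I_N => periodic_var p i)) p q =
  esumZ l ((size l)%:Z + q%:Z - p%:Z) (p.+1%:Z + s%:Z).
Proof.
elim: l s p => [|i l IHl] s p.
  rewrite big_nil mxE /= add0r; case: (eqVneq p q) => [->|neq_pq]; first by rewrite subrr.
  case E : (q%:Z - p%:Z) => [[|k]|k] //; case/eqP: neq_pq.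
  by apply: val_inj; rewrite /=; lia.
case=> i_s l_s; rewrite big_cons mxE (bigD1 p) //= !mxE eqxx (IHl s.+1) //.
rewrite -loop_varE.
have -> : \sum_(j | j != p) whirl (fun p0 : 'I_N => periodic_var p0 i) p j *
     (\big[mulmx/1%:M]_(j0 <- l) whirl (fun p0 : 'I_N => periodic_var p0 j0)) j q =
   esumZ l ((size l).+1%:Z + q%:Z - p%:Z) (p.+1%:Z + s%:Z).
  (* Row 0 has no subdiagonal entry; the matching [esum] has degree above the length of [l], so
     cutting down to a finite window loses nothing. *)
  case: (posnP p) => [p0|p_gt0].
    rewrite big1 => [|j jp]; last first.
      by rewrite !mxE eq_sym (negPf jp) p0 mul0r.
    have -> : (size l).+1%:Z + q%:Z - p%:Z = ((size l).+1 + q)%N%:Z by lia.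
    by rewrite /= esum_gt // ltnS leq_addr.
  have lt_p : (p.-1 < N)%N by have := ltn_ord p; lia.
  have up : (Ordinal lt_p).+1 = p by rewrite /= prednK.
  move: (Ordinal lt_p) up => u up.
  rewrite (bigD1 u) /=; last by rewrite -val_eqE /=; lia.
  rewrite [X in _ + X]big1 ?addr0 => [|j /andP[jp ju]].
    rewrite mxE -val_eqE /= -up eqxx ifN ?mul1r; last by lia.
    rewrite (IHl s.+1) //; congr (esumZ _ _ _); lia.
  by rewrite !mxE eq_sym (negPf jp) ifN ?mul0r // -up eqSS eq_sym.
rewrite /= in i_s *; rewrite i_s.
have -> : p.+1%:Z + s.+1%:Z = p.+1%:Z + s%:Z + 1 by lia.
have -> : (size l)%:Z + q%:Z - p%:Z = (size l).+1%:Z + q%:Z - p%:Z - 1 by lia.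
(* In degree zero only the second summand survives, in negative degree neither. *)
case: ((size l).+1%:Z + q%:Z - p%:Z) => [[|k]|k].
- by rewrite /= mulr0 add0r esum0.
- by rewrite (_ : k.+1%:Z - 1 = k%:Z) //; lia.
- by rewrite /= mulr0 addr0.
Qed.

Lemma Mtilde_whirl N (p q : 'I_N) :
  Mtilde x p.+1%:Z q.+1%:Z =
  (\big[mulmx/1%:M]_(i < m) whirl (fun p : 'I_N => periodic_var p i)) p q.
Proof.
have -> : \big[mulmx/1%:M]_(i < m) whirl (fun p : 'I_N => periodic_var p i) =
          \big[mulmx/1%:M]_(i <- enum 'I_m) whirl (fun p : 'I_N => periodic_var p i).
  by rewrite enumT [index_enum _]unlock.
rewrite (@whirl_prod_esum N _ 0).
  rewrite size_enum_ord /Mtilde addr0.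
  have -> : m%:Z + q.+1%:Z - p.+1%:Z = m%:Z + q%:Z - p%:Z by lia.
  by case: (_ - _) => k //; rewrite loopE_esum.
by rewrite val_enum_ord size_enum_ord.
Qed.

End LoopMatrix.

(** * The index sets as sets of positions, and the conclusion *)

Lemma mem_itvZ (lo hi z : int) : (z \in itvZ lo hi) = (lo <= z <= hi).
Proof.
apply/imfsetP/idP => [[k]|lo_z_hi].
  by rewrite /= mem_iota => kP ->; lia.
by exists (absz (z - lo)); rewrite /= ?mem_iota; lia.
Qed.

Lemma mem_bigfset (d : nat) (F : nat -> {fset int}) (z : int) :
  (z \in \big[fsetU/fset0]_(k < d) F k)%fset = [exists k : 'I_d, z \in F k].
Proof.
apply/bigfcupP/existsP => [[k _ zk]|[k zk]]; first by exists k.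
by exists k; rewrite // mem_index_enum.
Qed.

Lemma sort_fset_ord N (P : {set 'I_N}) (A : {fset int}) :
  (forall z, (z \in A) = [exists p in P, z == p.+1%:Z]) ->
  sort <=%R (enum_fset A) = [seq p.+1%:Z | p : 'I_N <- enum P].
Proof.
move=> memA; apply: lt_sorted_eq.
- by rewrite sort_lt_sorted fset_uniq.
- rewrite sorted_map; apply: (@sub_sorted _ (relpre (@nat_of_ord N) ltn)) => [i j|].
    by rewrite /= ltz_nat.
  by rewrite -sorted_map sorted_ltn_subseq enumT; exact: filter_subseq.
move=> z; rewrite mem_sort memA; apply/exists_inP/mapP => [[p pP /eqP ->]|[p pP ->]].
  by exists p; rewrite ?mem_enum.
by exists p; rewrite // -mem_enum.
Qed.

(** One form for both index sets: [I] has [lo = n - a] and [hi = n], [J] has [lo = 0] and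
    [hi = b]. *)
Lemma mem_block_itv n d (lo hi : nat -> nat) (z : int) : (0 < n)%N ->
  (forall k, (k < d)%N -> (hi k <= n)%N) ->
  (z \in \big[fsetU/fset0]_(k < d)
           itvZ ((k * n)%:Z + (lo k)%:Z + 1) ((k * n)%:Z + (hi k)%:Z))%fset =
  [exists p : 'I_(d * n), (lo (p %/ n) <= p %% n < hi (p %/ n))%N && (z == p.+1%:Z)].
Proof.
move=> n_gt0 le_hi.
rewrite (mem_bigfset d (fun k => itvZ ((k * n)%:Z + (lo k)%:Z + 1) ((k * n)%:Z + (hi k)%:Z))).
apply/existsP/existsP => [[k]|[p /andP[lo_p_hi /eqP->]]].
  rewrite mem_itvZ => lo_z_hi; have hik := le_hi k (ltn_ord k).
  pose j := absz (z - (k * n)%:Z - 1)%R.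
  have zE : z = (k * n + j)%N.+1%:Z by rewrite /j; lia.
  have lt_jn : (j < n)%N by rewrite /j; lia.
  have lt_p : (k * n + j < d * n)%N.
    have := leq_mul (ltn_ord k) (leqnn n); rewrite mulSn; lia.
  exists (Ordinal lt_p); rewrite /= modnMDl divnMDl // modn_small // divn_small // addn0.
  by rewrite zE eqxx andbT; lia.
have lt_k : (p %/ n < d)%N by rewrite ltn_divLR.
exists (Ordinal lt_k); rewrite mem_itvZ /=; have := divn_eq p n; lia.
Qed.

Lemma minor_loop_matrix (R : comNzRingType) (m n : nat) (x : 'I_m -> 'I_n -> R)
    (hn : (1 <= n)%N)
    (d : nat) (a b : nat -> nat)
    (ha : forall k, (k <= d)%N -> (a k <= n)%N)
    (hb : forall k, (k <= d)%N -> (b k <= n)%N)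
    (hab : (\sum_(k < d.+1) a k = \sum_(k < d.+1) b k)%N)
    (ha' : forall k, (k <= d)%N -> (n%:Z - m%:Z <= (a k)%:Z))
    (hb' : forall k, (k <= d)%N -> (n%:Z - m%:Z <= (b k)%:Z))
    (hX : forall k, (k < d)%N -> (n - a k.+1 <= m - (n - b k))%N) :
  minorZ (Mtilde x) (setI_ n d a) (setJ_ n d b) =
  \sum_(X : d.-tuple {set 'I_m} | admissible n a b X)
    \prod_(k < d.+1)
      minorM (Mbar x)
        (rowset n a b X k) (colset n a b X k).
Proof.
have lea k : (k <= d)%N -> (n - a k <= m)%N by move/ha'; lia.
have leb k : (k <= d)%N -> (n - b k <= m)%N by move/hb'; lia.
have card_eq : #|rows_of n d a| = #|cols_of n d b|.
  apply: card_rows_cols => //.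
  rewrite (eq_bigr (fun k : 'I_d.+1 => a k)) => [|k _]; last first.
    by have := ha k; rewrite -ltnS ltn_ord => /(_ isT); lia.
  rewrite hab; apply: eq_bigr => k _.
  by have := hb k; rewrite -ltnS ltn_ord => /(_ isT); lia.
rewrite /minorZ (@sort_fset_ord _ (rows_of n d a)); last first.
  move=> z; rewrite /setI_ (eq_bigr (fun k : 'I_d.+1 =>
    itvZ ((k * n)%:Z + (n - a k)%:Z + 1) ((k * n)%:Z + n%:Z))); last first.
    move=> k _; have := ha k; rewrite -ltnS ltn_ord mulSn => /(_ isT) leak.
    by congr itvZ; lia.
  rewrite (@mem_block_itv n d.+1 (fun k => n - a k)%N (fun=> n)) //.
  by apply: eq_existsb => p; rewrite inE ltn_pmod // andbT.
rewrite (@sort_fset_ord _ (cols_of n d b)); last first.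
  move=> z; rewrite /setJ_ (eq_bigr (fun k : 'I_d.+1 =>
    itvZ ((k * n)%:Z + 0%N%:Z + 1) ((k * n)%:Z + (b k)%:Z))); last first.
    by move=> k _; rewrite addr0.
  rewrite (@mem_block_itv n d.+1 (fun=> 0)%N b) //.
  by apply: eq_existsb => p; rewrite inE.
rewrite minor_seq_map -?cardE //.
rewrite (eq_minor_seq (N' := fun p q =>
  (\big[mulmx/1%:M]_(i < m) whirl (fun p => periodic_var x hn p i)) p q)) -?cardE //;
  last by move=> p q _ _; exact: Mtilde_whirl.
rewrite -/(minorM _ _ _).
have := minor0_tuples (periodic_varD x hn) hn lea leb hX.
rewrite {1}/minor0 card_eq eqxx => ->.
rewrite [RHS]big_mkcond; apply: eq_bigr => X _.
rewrite block_weight_admissible //; case: ifP => // _.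
apply: eq_bigr => k _; congr (minorM _ _ _).
(* For [j < n] the periodic variable is [x i j], so the whirls of one block multiply to [Mbar]. *)
rewrite /Mbar; apply: eq_bigr => j _; apply/matrixP => u v; rewrite !mxE.
rewrite /periodic_var (_ : Ordinal _ = j) //; apply: val_inj => /=.
by rewrite modn_small.
Qed.

Theorem theorem5p5 (R : realType) (m n : nat) (hm : (1 <= m)%N) (hn : (1 <= n)%N)
    (d : nat) (a b : nat -> nat)
    (ha : forall k, (k <= d)%N -> (a k <= n)%N)
    (hb : forall k, (k <= d)%N -> (b k <= n)%N)
    (hab : (\sum_(k < d.+1) a k = \sum_(k < d.+1) b k)%N)
    (ha' : forall k, (k <= d)%N -> (n%:Z - m%:Z <= (a k)%:Z))
    (hb' : forall k, (k <= d)%N -> (n%:Z - m%:Z <= (b k)%:Z))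
    (hX : forall k, (k < d)%N -> (n - a k.+1 <= m - (n - b k))%N) :
  minorZ (Mtilde (indet R[i] (m:=m) (n:=n))) (setI_ n d a) (setJ_ n d b) =
  \sum_(X : d.-tuple {set 'I_m} | admissible n a b X)
    \prod_(k < d.+1)
      minorM (Mbar (indet R[i] (m:=m) (n:=n)))
        (rowset n a b X k) (colset n a b X k).
Proof. exact: minor_loop_matrix. Qed.
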